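(* Let $d \geq 1$, let $k, \ell \geq 0$ be integers with $k+\ell \leq d-1$, and let $a \geq 1$ be an integer. Consider the finite sequence $$(\delta_0,\ldots,\delta_d)=(1, \underbrace{0,\ldots,0}_{k},a,\ldots,a,\underbrace{0,\ldots,0}_{\ell})$$ of length $d+1$ (so that $\delta_0=1$, $\delta_i=0$ for $1\le i\le k$, $\delta_i=a$ for $k+1\le i\le d-\ell$, and $\delta_i=0$ for $d-\ell+1\le i\le d$). Then there exists an integral convex polytope $\mathcal{P} \subset \mathbb{R}^d$ of dimension $d$ whose $\delta$-vector coincides with $(\delta_0,\ldots,\delta_d)$ if and only if $k \leq \ell$.
   Context: An integral convex polytope is a convex polytope all of whose vertices have integer coordinates. For an integral convex polytope $\mathcal{P}\subset\mathbb{R}^d$ of dimension $d$, let $i(\mathcal{P},n)=|n\mathcal{P}\cap\mathbb{Z}^d|$ for integers $n\ge 0$ (this is a polynomial in $n$ of degree $d$, the Ehrhart polynomial). The $\delta$-vector $\delta(\mathcal{P})=(\delta_0,\ldots,\delta_d)$ is defined by $(1-\lambda)^{d+1}\sum_{n=0}^{\infty} i(\mathcal{P},n)\lambda^n=\sum_{j=0}^{d}\delta_j\lambda^j$. *)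

(* Defs.v *)
From HB Require Import structures.
From mathcomp Require Import all_boot all_order all_algebra finmap.
From mathcomp Require Import all_classical reals.

Set Implicit Arguments.
Unset Strict Implicit.
Unset Printing Implicit Defensive.

Import Order.TTheory GRing.Theory Num.Theory.

Local Open Scope classical_set_scope.
Local Open Scope ring_scope.

Section Polytope.
Context (R : realType) (d : nat).

Definition conv_hull (n : nat) (v : 'I_n -> 'rV[R]_d) : set 'rV[R]_d :=
  [set x | exists w : 'I_n -> R,
     [/\ forall i, 0 <= w i, \sum_i w i = 1 & x = \sum_i w i *: v i]].

Definition convex_polytope (P : set 'rV[R]_d) : Prop :=
  exists (n : nat) (v : 'I_n -> 'rV[R]_d), P = conv_hull v.

(* The vertices of a polytope are its extreme points: those lying in the
   relative interior of no nondegenerate segment contained in P. *)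
Definition vertex (P : set 'rV[R]_d) (x : 'rV[R]_d) : Prop :=
  P x /\ forall (y z : 'rV[R]_d) (t : R), P y -> P z -> 0 < t < 1 ->
    x = t *: y + (1 - t) *: z -> y = z.

Definition lattice_points : set 'rV[R]_d :=
  [set x | forall j, x 0 j \is a Num.int].

Definition integral_polytope (P : set 'rV[R]_d) : Prop :=
  convex_polytope P /\ vertex P `<=` lattice_points.

Definition affinely_independent (n : nat) (x : 'I_n.+1 -> 'rV[R]_d) : bool :=
  row_free (\matrix_(i < n) (x (lift ord0 i) - x ord0)).

(* n is the dimension of the affine hull of A: n + 1 is the maximal number of
   affinely independent points of A. *)
Definition has_dim (A : set 'rV[R]_d) (n : nat) : Prop :=
  (exists x : 'I_n.+1 -> 'rV[R]_d,
     affinely_independent x /\ forall i, A (x i)) /\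
  (forall (m : nat) (x : 'I_m.+1 -> 'rV[R]_d),
     affinely_independent x -> (forall i, A (x i)) -> (m <= n)%N).

(* [fset_set] returns the empty set on infinite sets; for a polytope P the set
   below is bounded and discrete, hence finite. *)
Definition ehrhart (P : set 'rV[R]_d) (n : nat) : nat :=
  #|` fset_set ([set n%:R *: x | x in P] `&` lattice_points) |.

(* Formal power series are represented by their coefficient sequences, on
   which the product is the Cauchy product. *)
Definition series_mul (f g : nat -> int) (m : nat) : int :=
  \sum_(i < m.+1) f i * g (m - i)%N.

(* (1 - X)^(d+1) * (\sum_n i(P, n) X^n) = \sum_(j <= d) delta_j X^j in Z[[X]];
   the exponent involves the ambient dimension d, so this is the usual
   delta-vector for P of full dimension. *)
Definition is_delta_vector (P : set 'rV[R]_d) (delta : 'I_d.+1 -> int) : Prop :=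
  forall m : nat,
    series_mul (fun i => ((1 - 'X : {poly int}) ^+ d.+1)`_i)
               (fun n => (ehrhart P n)%:Z) m
    = (\sum_(j < d.+1) delta j *: 'X^j : {poly int})`_m.

End Polytope.

(* (1, 0, .., 0, a, .., a, 0, .., 0) with k leading and l trailing zeros *)
Definition block_vector (d k l a : nat) (i : 'I_d.+1) : int :=
  if i == 0%N :> nat then 1
  else if (k < i <= d - l)%N then a%:Z else 0.

(* Main.v *)
Require Import Defs.
From mathcomp Require Import all_boot all_order all_algebra finmap.
From mathcomp Require Import all_classical reals.
From mathcomp Require Import zify ring lra.

(* For a lattice simplex with d + 1 vertices, every lattice point of the cone
   over it is uniquely the sum of a point of the box (barycentric coordinates
   in [0, 1)) and of a nonnegative integer combination of the vertices, so
   delta_m is the number of box points of height m.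

   Necessity: if k > 0 then delta_1 = 0 forces P to have only d + 1 lattice
   points; these are its vertices and P is a simplex. A box point of height
   d - l has an opposite, of height at most (d + 1) - (d - l) = l + 1; that
   height being positive with a nonzero delta, it is at least k + 1.

   Sufficiency: put N = d - l - k and M = a N + 1, and take a simplex whose box
   group is Z/M, generated by the barycentric coordinates (mod 1)
   (- N, 1^(N + k), (- 1)^k, 0^(l - k)) / M. For 0 < j < M the j-th multiple has
   height k + ceil(N j / M), and each value k + 1, .., k + N occurs a times. *)

Set Implicit Arguments.
Unset Strict Implicit.
Unset Printing Implicit Defensive.

Import Order.TTheory GRing.Theory Num.Theory.

Local Open Scope classical_set_scope.
Local Open Scope ring_scope.

(** * Generating functions as integer polynomials *)

Lemma series_mul_coefM (p q : {poly int}) (g : nat -> int) m :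
  (forall n, (n <= m)%N -> g n = q`_n) ->
  series_mul (fun i => p`_i) g m = (p * q)`_m.
Proof.
move=> gq; rewrite coefM /series_mul; apply: eq_bigr => i _.
by rewrite gq ?leq_subr.
Qed.

Lemma exp_oneBXn (m r : nat) :
  exists q : {poly int}, (1 - 'X^m) ^+ r = 1 + q * 'X^m.
Proof.
elim: r => [|r [q IH]]; first by exists 0; rewrite mul0r addr0 expr0.
by exists (q - 1 - q * 'X^m); rewrite exprS IH; ring.
Qed.

(** [1 - 'X] times the truncated geometric series is [1 - 'X^(m.+1)], so up to degree [m] the
    truncation acts as an inverse of [1 - 'X]. This keeps the Ehrhart series within polynomials. *)
Lemma coef_mul_oneBX_geometric (Q : {poly int}) (r m : nat) :
  ((1 - 'X) ^+ r * (Q * (\sum_(i < m.+1) 'X^i) ^+ r))`_m = Q`_m.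
Proof.
rewrite mulrCA -exprMn.
have -> : (1 - 'X : {poly int}) * \sum_(i < m.+1) 'X^i = 1 - 'X^(m.+1).
  by rewrite -opprB mulNr -subrX1 opprB.
have [q ->] := exp_oneBXn m.+1 r.
by rewrite mulrDr mulr1 coefD mulrA coefMXn ltnSn addr0.
Qed.

Lemma coef_sum_Xn (I : finType) (h : I -> nat) (n : nat) :
  (\sum_i 'X^(h i) : {poly int})`_n = #|[set i | h i == n]%SET|%:Z.
Proof.
rewrite coef_sum -sum1_card -natz natr_sum.
rewrite [RHS]big_mkcond; apply: eq_bigr => i _; rewrite coefXn inE eq_sym.
by case: eqP.
Qed.

(** Distributing the power picks one exponent per factor, recorded by a finite function; the
    resulting pairs will index the lattice points of dilated simplices. *)
Lemma sum_Xn_mul_geometric (J : finType) (h : J -> nat) (r K : nat) :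
  (\sum_j 'X^(h j)) * (\sum_(i < K.+1) 'X^i) ^+ r
  = \sum_(jz : J * {ffun 'I_r -> 'I_K.+1}) 'X^(h jz.1 + \sum_i jz.2 i)
  :> {poly int}.
Proof.
rewrite -[X in _ ^+ X]card_ord -prodr_const bigA_distr_bigA big_distrlr /=.
rewrite pair_big; apply: eq_bigr => -[j z] _ /=.
by rewrite exprD; congr (_ * _); rewrite -prodrXr.
Qed.

(** * Barycentric coordinates and box points *)

Definition combination (R : realType) (d n : nat) (v : 'I_n -> 'rV[R]_d)
  (w : 'I_n -> R) : 'rV[R]_d := \sum_i w i *: v i.

Definition affine_free (R : realType) (d n : nat) (v : 'I_n -> 'rV[R]_d) :=
  forall w, \sum_i w i = 0 -> combination v w = 0 -> forall i, w i = 0.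

(** Half-open parallelepiped of the cone over [v], stored by coordinates instead of points; the sum
    of the coordinates is the height in the cone. *)
Definition box (R : realType) (d n : nat) (v : 'I_n -> 'rV[R]_d) :
    set ('I_n -> R) :=
  [set w | [/\ forall i, 0 <= w i < 1, \sum_i w i \is a Num.int
             & lattice_points (combination v w)]].

Lemma combinationD (R : realType) (d n : nat) (v : 'I_n -> 'rV[R]_d) w u :
  combination v (fun i => w i + u i) = combination v w + combination v u.
Proof. by rewrite -big_split; apply: eq_bigr => i _; rewrite scalerDl. Qed.

Lemma combinationN (R : realType) (d n : nat) (v : 'I_n -> 'rV[R]_d) w :
  combination v (fun i => - w i) = - combination v w.
Proof. by rewrite -sumrN; apply: eq_bigr => i _; rewrite scaleNr. Qed.

Lemma combinationZ (R : realType) (d n : nat) (v : 'I_n -> 'rV[R]_d) w c :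
  combination v (fun i => c * w i) = c *: combination v w.
Proof. by rewrite scaler_sumr; apply: eq_bigr => i _; rewrite scalerA. Qed.

Lemma combination_delta (R : realType) (d n : nat) (v : 'I_n -> 'rV[R]_d) i :
  combination v (fun j => (j == i)%:R) = v i.
Proof.
rewrite /combination (bigD1 i) //= eqxx scale1r big1 ?addr0 // => j /negbTE ->.
by rewrite scale0r.
Qed.

Lemma lattice_pointsD (R : realType) (d : nat) (x y : 'rV[R]_d) :
  lattice_points x -> lattice_points y -> lattice_points (x + y).
Proof. by move=> hx hy j; rewrite mxE rpredD. Qed.

Lemma lattice_pointsN (R : realType) (d : nat) (x : 'rV[R]_d) :
  lattice_points x -> lattice_points (- x).
Proof. by move=> hx j; rewrite mxE rpredN. Qed.

Lemma lattice_combination (R : realType) (d n : nat) (v : 'I_n -> 'rV[R]_d) w :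
  (forall i, lattice_points (v i)) -> (forall i, w i \is a Num.int) ->
  lattice_points (combination v w).
Proof.
move=> hv hw j; rewrite summxE rpred_sum // => i _.
by rewrite mxE rpredM // hv.
Qed.

Lemma conv_hull_generator (R : realType) (d n : nat) (v : 'I_n -> 'rV[R]_d) i :
  conv_hull v (v i).
Proof.
exists (fun j => (j == i)%:R); split=> [j||].
- by rewrite ler0n.
- by rewrite (bigD1 i) //= eqxx big1 ?addr0 // => j /negbTE ->.
- by rewrite -[LHS](combination_delta v).
Qed.

Lemma eq_add_nat (R : realType) (a b : R) (m n : nat) :
  0 <= a < 1 -> 0 <= b < 1 -> a + m%:R = b + n%:R -> m = n.
Proof.
move=> a01 b01 e; apply/eqP; rewrite eqn_leq -ltnS -[(n <= m)%N]ltnS.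
by rewrite -!(ltr_nat R) -(addn1 m) -(addn1 n) !natrD; apply/andP; split; lra.
Qed.

(** * Ehrhart series of a lattice simplex *)

Section EhrhartSimplex.
Context (R : realType) (d r : nat) (v : 'I_r.+1 -> 'rV[R]_d).
Context (J : finType) (b : J -> 'I_r.+1 -> R) (ht : J -> nat).
Hypotheses (vZ : forall i, lattice_points (v i)) (vfree : affine_free v).
Hypotheses (b_inj : injective b) (b_box : forall j, box v (b j)).
Hypotheses (box_b : forall w, box v w -> exists j, b j = w).
Hypothesis (sum_b : forall j, \sum_i b j i = (ht j)%:R).

(** Coordinates of a lattice point of the [n]-th dilate sum to [n]; their fractional parts form a
    box point. Their integer parts are at most [n], so one bound [K] serves all [n <= K] with a
    finite index type. *)
Lemma ehrhart_simplex (K n : nat) : (n <= K)%N ->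
  ehrhart (conv_hull v) n =
  #|[set jz : J * {ffun 'I_r.+1 -> 'I_K.+1}
       | (ht jz.1 + \sum_i jz.2 i)%N == n]%SET|.
Proof.
move=> nK; set S := finset _.
pose t (jz : J * {ffun 'I_r.+1 -> 'I_K.+1}) i := b jz.1 i + (jz.2 i : nat)%:R.
pose phi jz := combination v (t jz).
have sum_t jz : \sum_i t jz i = (ht jz.1 + \sum_i jz.2 i)%:R.
  by rewrite big_split sum_b natrD natr_sum.
have t_ge0 jz i : 0 <= t jz i.
  by case: (b_box jz.1) => /(_ i)/andP[b0 _] _ _; rewrite addr_ge0.
(* At equal height, equal points have equal coordinates by [vfree]; then the integer parts agree,
   and so do the box points. *)
have phi_inj : {in S &, injective phi}.
  move=> x y; rewrite !inE => /eqP hx /eqP hy exy.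
  have txy i : t x i = t y i.
    apply/eqP; rewrite -subr_eq0; apply/eqP.
    have sum0 : \sum_i (t x i + - t y i) = 0.
      by rewrite big_split /= sumrN !sum_t hx hy subrr.
    have comb0 : combination v (fun i => t x i + - t y i) = 0.
      by rewrite combinationD combinationN -/(phi x) exy subrr.
    exact: (vfree sum0 comb0).
  have zxy i : x.2 i = y.2 i :> nat.
    case: (b_box x.1) (b_box y.1) => [bx _ _] [by_ _ _].
    exact: eq_add_nat (bx i) (by_ i) (txy i).
  case: x y txy zxy {hx hy exy} => [j z] [j' z'] /= txy zxy.
  congr (_, _); last by apply/ffunP => i; apply/val_inj/zxy.
  by apply/b_inj/funext => i; move: (txy i); rewrite /t /= zxy => /addIr.
rewrite /ehrhart.
have -> : [set n%:R *: x | x in conv_hull v] `&` lattice_points (R:=R) (d:=d) =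
    phi @` [set` S].
  apply/seteqP; split=> x /=.
    move=> [[p [w [w0 w1 ->]] <-]] xZ.
    pose u i := n%:R * w i.
    have u0 i : 0 <= u i by rewrite mulr_ge0.
    have sum_u : \sum_i u i = n%:R by rewrite -mulr_sumr w1 mulr1.
    pose z i := Num.truncn (u i).
    have zu i : (z i)%:R <= u i < (z i).+1%:R by exact: truncn_itv.
    have box_u : box v (fun i => u i + - (z i)%:R).
      split=> [i||].
      - move: (zu i); rewrite -addn1 natrD => /andP[? ?].
        by apply/andP; split; lra.
      - by rewrite big_split /= sum_u sumrN -natr_sum rpredB ?rpred_nat.
      - rewrite combinationD combinationN; apply: lattice_pointsD.
          by rewrite combinationZ.
        by apply/lattice_pointsN/lattice_combination.
    have [j bj] := box_b box_u.
    have z_le i : (z i < K.+1)%N.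
      rewrite ltnS (leq_trans _ nK) // -(ler_nat R).
      have /andP[/le_trans -> //] := zu i.
      by rewrite -sum_u (bigD1 i) //= lerDl sumr_ge0.
    have tu : t (j, [ffun i => Ordinal (z_le i)]) = u.
      by apply/funext => i; rewrite /t /= ffunE bj /= subrK.
    exists (j, [ffun i => Ordinal (z_le i)]).
      by rewrite /= inE -(eqr_nat R) -sum_t tu sum_u.
    by rewrite /phi tu combinationZ.
  move=> [y]; rewrite inE => /eqP hy <-{x}.
  have sum_ty : \sum_i t y i = n%:R by rewrite sum_t hy.
  split; last first.
    rewrite /phi combinationD; apply: lattice_pointsD.
      by case: (b_box y.1).
    exact: lattice_combination.
  (* Dilation by 0 has no inverse, but then all coordinates vanish and any point of the hull is a
     preimage. *)
  have [n0|n_gt0] := posnP n.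
    exists (v ord0); first exact: conv_hull_generator.
    rewrite n0 scale0r /phi /combination big1 // => i _.
    have /psumr_eq0P : \sum_i t y i = 0 by rewrite sum_ty n0.
    by move=> -> //; rewrite scale0r.
  have n_neq0 : n%:R != 0 :> R by rewrite pnatr_eq0 -lt0n.
  exists (combination v (fun i => n%:R^-1 * t y i)).
    exists (fun i => n%:R^-1 * t y i); split=> // [i|].
      by rewrite mulr_ge0 ?invr_ge0.
    by rewrite -mulr_sumr sum_ty mulVf.
  by rewrite combinationZ scalerA mulfV // scale1r.
rewrite fset_set_image ?finite_finset // card_in_imfset; last first.
  move=> x y; rewrite !in_fset_set ?finite_finset //.
  by rewrite !mem_setE; apply: phi_inj.
have -> : fset_set [set` S] = [fset x in S]%fset.
  by apply/fsetP => x; rewrite in_fset_set ?finite_finset // mem_setE !inE.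
by rewrite card_finset.
Qed.

Lemma delta_simplex (m : nat) :
  series_mul (fun i => ((1 - 'X : {poly int}) ^+ r.+1)`_i)
             (fun n => (ehrhart (conv_hull v) n)%:Z) m
  = (\sum_j 'X^(ht j))`_m.
Proof.
pose q : {poly int} := (\sum_j 'X^(ht j)) * (\sum_(i < m.+1) 'X^i) ^+ r.+1.
rewrite (@series_mul_coefM _ q) ?coef_mul_oneBX_geometric // => n nm.
by rewrite /q (ehrhart_simplex nm) sum_Xn_mul_geometric coef_sum_Xn.
Qed.

End EhrhartSimplex.

(** * Vertices of a convex hull *)

Lemma combination_weight1 (R : realType) (d n : nat) (v : 'I_n -> 'rV[R]_d)
    w i :
  (forall j, 0 <= w j) -> \sum_j w j = 1 -> w i = 1 -> combination v w = v i.
Proof.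
move=> w0 w1 wi; rewrite -(combination_delta v i); congr combination.
apply/funext => j; have [->|ji] := eqVneq j i; first by rewrite wi.
have : \sum_(k | k != i) w k = 0.
  by move: w1; rewrite (bigD1 i) //= wi; lra.
by move=> /psumr_eq0P ->.
Qed.

(** Isolating one generator puts the point on a segment from it to a point spanned by the others,
    whose weights are divided by [1 - w i]. *)
Lemma combination_split (R : realType) (d n : nat) (v : 'I_n -> 'rV[R]_d) w i :
  (forall j, 0 <= w j) -> \sum_j w j = 1 -> w i != 1 ->
  exists u : 'I_n -> R,
    [/\ forall j, 0 <= u j, \sum_j u j = 1, u i = 0, w i < 1 &
        combination v w = w i *: v i + (1 - w i) *: combination v u].
Proof.
move=> w0 w1 wi.
have sum_w : \sum_(j | j != i) w j = 1 - w i.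
  by move: w1; rewrite (bigD1 i) //=; lra.
have wi1 : w i < 1.
  by rewrite lt_neqAle wi -subr_ge0 -sum_w sumr_ge0.
have wi0 : 1 - w i != 0 by rewrite subr_eq0 eq_sym.
exists (fun j => if j == i then 0 else w j / (1 - w i)); split=> //.
- by move=> j; case: eqP => // _; rewrite divr_ge0 // subr_ge0 ltW.
- rewrite (bigD1 i) //= eqxx add0r (eq_bigr (fun j => w j / (1 - w i))).
    by rewrite -mulr_suml sum_w mulfV.
  by move=> j /negbTE ->.
- by rewrite eqxx.
rewrite -combinationZ /combination (bigD1 i) //=; congr (_ + _).
rewrite [RHS](bigD1 i) //= eqxx mulr0 scale0r add0r.
by apply: eq_bigr => j /negbTE ->; rewrite mulrC divfK.
Qed.

(** Some weight is nonzero. If it is below 1, the point is strictly between [v i] and a point of the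
    hull, and extremality makes these two coincide. *)
Lemma vertex_conv_hull (R : realType) (d n : nat) (v : 'I_n -> 'rV[R]_d) x :
  vertex (conv_hull v) x -> exists i, x = v i.
Proof.
move=> [[w [w0 w1 xw]] xv].
have [[i wi]|w_0] := pselect (exists i, w i != 0); last first.
  move: w1; rewrite big1 => [/eqP|i _]; first by rewrite eq_sym oner_eq0.
  by apply/eqP; apply: contra_notT w_0 => wi; exists i.
exists i; have [wi1|wi1] := eqVneq (w i) 1.
  by rewrite xw -/(combination v w) (combination_weight1 v w0 w1 wi1).
have [u [u0 u1 _ wi_lt1 wu]] := combination_split v w0 w1 wi1.
have xE : x = w i *: v i + (1 - w i) *: combination v u by rewrite xw.
have vu : v i = combination v u.
  apply: (xv _ _ (w i) _ _ _ xE); first exact: conv_hull_generator.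
    by exists u.
  by rewrite wi_lt1 lt_neqAle eq_sym wi w0.
by rewrite xE -vu -scalerDl addrC subrK scale1r.
Qed.

Lemma conv_hull_sub (R : realType) (d m n : nat) (u : 'I_m -> 'rV[R]_d)
    (v : 'I_n -> 'rV[R]_d) :
  (forall j, conv_hull v (u j)) -> conv_hull u `<=` conv_hull v.
Proof.
move=> /choice[W hW] _ [w [w0 w1 ->]].
exists (fun k => \sum_j w j * W j k); split=> [k||].
- by apply: sumr_ge0 => j _; rewrite mulr_ge0 //; case: (hW j).
- rewrite exchange_big /= -w1; apply: eq_bigr => j _.
  by rewrite -mulr_sumr; case: (hW j) => _ -> _; rewrite mulr1.
- transitivity (\sum_j \sum_k (w j * W j k) *: v k).
    apply: eq_bigr => j _; case: (hW j) => _ _ ->; rewrite scaler_sumr.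
    by apply: eq_bigr => k _; rewrite scalerA.
  by rewrite exchange_big; apply: eq_bigr => k _; rewrite scaler_suml.
Qed.

Lemma conv_hull_drop (R : realType) (d n : nat) (v : 'I_n.+1 -> 'rV[R]_d) i :
  conv_hull (v \o lift i) (v i) -> conv_hull v = conv_hull (v \o lift i).
Proof.
move=> hi; apply/seteqP; split; apply: conv_hull_sub => j.
  have [<- //|ij] := eqVneq i j.
  have [k -> _] := unlift_some ij.
  exact: (conv_hull_generator (v \o lift i)).
exact: conv_hull_generator.
Qed.

(** If [v i] lies inside a segment, averaging the coordinates of the endpoints gives weights [c] for
    [v i]. Either [c i = 1] and both endpoints are [v i], or the equation can be solved for [v i] in
    terms of the other generators. *)
Lemma vertex_nonredundant (R : realType) (d n : nat)
    (v : 'I_n.+1 -> 'rV[R]_d) i :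
  ~ conv_hull (v \o lift i) (v i) -> vertex (conv_hull v) (v i).
Proof.
move=> hi; split; first exact: conv_hull_generator.
move=> y z t [a [a0 a1 ->]] [b [b0 b1 ->]] /andP[t0 t1] vi.
pose c j := t * a j + (1 - t) * b j.
have c0 j : 0 <= c j.
  by rewrite addr_ge0 // mulr_ge0 // ?ltW // subr_gt0.
have c1 : \sum_j c j = 1.
  by rewrite big_split /= -!mulr_sumr a1 b1; lra.
have vc : v i = combination v c.
  by rewrite combinationD !combinationZ.
have [ci|ci] := eqVneq (c i) 1.
  (* A proper average of two numbers at most 1 equals 1 only if both do. *)
  have ai : a i <= 1 by rewrite -a1 (bigD1 i) //= lerDl sumr_ge0.
  have bi : b i <= 1 by rewrite -b1 (bigD1 i) //= lerDl sumr_ge0.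
  rewrite -!/(combination _ _) !(@combination_weight1 _ _ _ _ _ i) //.
    by move: ci; rewrite /c; nra.
  by move: ci; rewrite /c; nra.
case: hi; have [u [u0 u1 ui ci1 cu]] := combination_split v c0 c1 ci.
have {}vi : v i = combination v u.
  have ci0 : 1 - c i != 0 by rewrite subr_eq0 eq_sym.
  apply: (scalerI ci0); rewrite scalerBl scale1r [X in X - _]vc cu.
  by rewrite addrAC subrr add0r.
exists (u \o lift i); split=> //=.
  by rewrite -u1 [RHS](bigD1_ord i) //= ui add0r.
by rewrite [LHS]vi /combination (bigD1_ord i) //= ui scale0r add0r.
Qed.

(** Redundant generators are removed one at a time; those that remain are vertices, and distinct
    since a repeated generator is redundant. *)
Lemma convex_polytope_vertices (R : realType) (d : nat) (P : set 'rV[R]_d) :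
  convex_polytope P ->
  exists (n : nat) (v : 'I_n -> 'rV[R]_d),
    [/\ P = conv_hull v, injective v & forall i, vertex P (v i)].
Proof.
move=> [n [v Pv]]; elim: n v Pv => [|n IH] v Pv.
  have no (i : 'I_0) : False by case: i.
  by exists 0%N, v; split.
have [[i hi]|nored] := pselect (exists i, conv_hull (v \o lift i) (v i)).
  by apply: (IH (v \o lift i)); rewrite -conv_hull_drop.
exists n.+1, v; split=> // [i j vij|i]; last first.
  by rewrite Pv; apply: vertex_nonredundant => hi; apply: nored; exists i.
apply/eqP; apply: contra_notT nored => ij; exists i.
have [k e _] := unlift_some ij.
by rewrite vij e; apply: (conv_hull_generator (v \o lift i)).
Qed.

(** * Affine independence and dimension *)

Lemma affinely_independent_free (R : realType) (d n : nat)
    (v : 'I_n.+1 -> 'rV[R]_d) :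
  affinely_independent v -> affine_free v.
Proof.
move=> hv w w0 wv.
have sum_w : w ord0 = - \sum_i w (lift ord0 i).
  by apply/eqP; move/eqP: w0; rewrite big_ord_recl addr_eq0.
have row0 : \row_i w (lift ord0 i) = 0.
  apply: (row_free_inj hv); rewrite mul0mx -[RHS]wv.
  rewrite mulmx_sum_row /combination big_ord_recl sum_w scaleNr scaler_suml.
  rewrite -sumrN -big_split /=; apply: eq_bigr => i _.
  by rewrite mxE rowK scalerBr addrC.
have wl i : w (lift ord0 i) = 0 by move/rowP: row0 => /(_ i); rewrite !mxE.
move=> i; have [->|] := eqVneq i ord0; first by rewrite sum_w big1 ?oppr0.
by rewrite eq_sym => /unlift_some[j -> _].
Qed.

(** The difference matrix of [x] factors through that of [v], so the latter has rank at least [m].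
    This bounds the number of generators from below, and in the extreme case the hull is a
    simplex. *)
Lemma conv_hull_affinely_independent (R : realType) (d r m : nat)
    (v : 'I_r.+1 -> 'rV[R]_d) (x : 'I_m.+1 -> 'rV[R]_d) :
  affinely_independent x -> (forall i, conv_hull v (x i)) ->
  (m <= r)%N /\ (m = r -> affinely_independent v).
Proof.
move=> hx /choice[W hW].
set A := \matrix_(k < r) (v (lift ord0 k) - v ord0).
pose C := \matrix_(i < m, k < r)
  (W (lift ord0 i) (lift ord0 k) - W ord0 (lift ord0 k)).
have xW i : x i = v ord0 + \sum_k W i (lift ord0 k) *: row k A.
  case: (hW i) => _ w1 ->; rewrite big_ord_recl.
  have -> : W i ord0 = 1 - \sum_k W i (lift ord0 k).
    by rewrite -w1 big_ord_recl addrK.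
  rewrite scalerBl scale1r -addrA; congr (_ + _).
  rewrite scaler_suml -sumrN -big_split; apply: eq_bigr => k _ /=.
  by rewrite rowK scalerBr addrC.
have XCA : \matrix_(i < m) (x (lift ord0 i) - x ord0) = C *m A.
  apply/row_matrixP => i; rewrite rowK row_mul mulmx_sum_row !xW.
  rewrite opprD addrACA subrr add0r -sumrB; apply: eq_bigr => k _.
  by rewrite -scalerBl !mxE.
have mA : (m <= \rank A)%N.
  move: hx; rewrite /affinely_independent XCA => /eqP {1}<-.
  exact: mxrankM_maxr.
split; first exact: leq_trans mA (rank_leq_row _).
move=> mr; apply/eqP/anti_leq; rewrite rank_leq_row /=.
by rewrite mr in mA.
Qed.

(** * Finiteness and symmetry of the box *)

Lemma finite_bounded_lattice (R : realType) (d : nat) (B : R) :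
  finite_set [set x : 'rV[R]_d |
    lattice_points x /\ forall j, `|x 0 j| <= B].
Proof.
pose K := (Num.truncn B).+1.
pose f (g : {ffun 'I_d -> 'I_(K + K).+1}) : 'rV[R]_d :=
  \row_j ((g j : nat)%:R - K%:R).
apply: (@sub_finite_set _ _ (f @` setT)); last exact/finite_image/finite_finset.
move=> x [xZ xB]; have BK : B < K%:R by exact: truncnS_gt.
have xK j : - K%:R < x 0 j < K%:R by rewrite -ltr_norml (le_lt_trans (xB j)).
have xn j : x 0 j + K%:R \is a Num.nat.
  rewrite natrEint rpredD ?xZ ?rpred_nat //=.
  by case/andP: (xK j); lra.
pose z j := Num.truncn (x 0 j + K%:R).
have zE j : (z j)%:R = x 0 j + K%:R by exact: truncnK.
have z_lt j : (z j < (K + K).+1)%N.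
  by rewrite ltnS -(ler_nat R) zE natrD; case/andP: (xK j); lra.
exists [ffun j => Ordinal (z_lt j)] => //.
by apply/rowP => j; rewrite mxE ffunE /= zE addrK.
Qed.

Lemma combination_bounded (R : realType) (d n : nat) (v : 'I_n -> 'rV[R]_d) :
  exists B, 0 <= B /\ forall w, (forall i, 0 <= w i <= 1) ->
    forall j, `|combination v w 0 j| <= B.
Proof.
exists (\sum_i \sum_j `|v i 0 j|); split.
  by apply: sumr_ge0 => i _; apply: sumr_ge0.
move=> w w01 j; rewrite summxE; apply: (le_trans (ler_norm_sum _ _ _)).
apply: ler_sum => i _; rewrite mxE normrM.
have /andP[w0 w1] := w01 i.
apply: (@le_trans _ _ `|v i 0 j|).
  by rewrite ger0_norm // ler_piMl.
by rewrite (bigD1 j) //= lerDl sumr_ge0.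
Qed.

Lemma finite_conv_hull_lattice (R : realType) (d n : nat)
    (v : 'I_n -> 'rV[R]_d) :
  finite_set (conv_hull v `&` lattice_points (R:=R) (d:=d)).
Proof.
have [B [_ hB]] := combination_bounded v.
apply: sub_finite_set (finite_bounded_lattice d B).
move=> _ [[w [w0 w1 ->]] xZ]; split=> // j; apply: hB => i.
by rewrite w0 -w1 (bigD1 i) //= lerDl sumr_ge0.
Qed.

(** By affine freeness a box point is determined by its height and its combination, and this pair is
    a bounded lattice point in dimension [1 + d]. *)
Lemma finite_box (R : realType) (d n : nat) (v : 'I_n -> 'rV[R]_d) :
  affine_free v -> finite_set (box v).
Proof.
move=> vfree; have [B [B0 hB]] := combination_bounded v.
pose g w : 'rV[R]_(1 + d) := row_mx (\sum_i w i)%:M (combination v w).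
have g_inj : injective g.
  move=> w u /eq_row_mx[/matrixP/(_ 0 0)]; rewrite !mxE eqxx !mulr1n => sum_wu.
  move=> comb_wu; apply/funext => i; apply/eqP; rewrite -subr_eq0; apply/eqP.
  apply: (vfree (fun i => w i + - u i)).
    by rewrite big_split /= sumrN sum_wu subrr.
  by rewrite combinationD combinationN comb_wu subrr.
have := finite_bounded_lattice (1 + d) (B + n%:R).
move=> /(finite_preimage (f := g)) fin.
apply: (sub_finite_set _ (fin _)); last by move=> x y _ _; apply: g_inj.
move=> w [w01 sumZ combZ]; split=> j; rewrite !mxE; case: splitP => k _ //=.
- by rewrite mxE ord1 eqxx.
- rewrite mxE ord1 eqxx mulr1n ger0_norm; last first.
    by apply: sumr_ge0 => i _; case/andP: (w01 i).
  apply: (@le_trans _ _ (\sum_(i < n) 1)).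
    by apply: ler_sum => i _; case/andP: (w01 i) => _ /ltW.
  by rewrite sumr_const card_ord lerDr.
- rewrite (@le_trans _ _ B) ?lerDl // hB // => i.
  by case/andP: (w01 i) => -> /ltW.
Qed.

(** The witness is the inverse in the box group: [1 - w i] where [w i] is nonzero, and 0 elsewhere.
    The two heights add up to the number of nonzero coordinates, at most [n]. *)
Lemma box_opp (R : realType) (d n : nat) (v : 'I_n -> 'rV[R]_d) w :
  (forall i, lattice_points (v i)) -> box v w -> \sum_i w i != 0 ->
  exists u, [/\ box v u, 0 < \sum_i u i & \sum_i u i <= n%:R - \sum_i w i].
Proof.
move=> vZ [w01 sumZ combZ] sum_neq0.
exists (fun i => (w i != 0)%:R + - w i).
have u01 i : 0 <= (w i != 0)%:R + - w i < 1.
  have /andP[w0 w1] := w01 i; have [->|wi] := eqVneq (w i) 0.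
    by rewrite subrr lexx ltr01.
  move: w0; rewrite le_eqVlt eq_sym (negbTE wi) /= => ?.
  by apply/andP; split; lra.
split.
- split=> //.
    rewrite big_split /= sumrN rpredB // rpred_sum // => i _.
    by rewrite rpred_nat.
  rewrite combinationD combinationN; apply: lattice_pointsD.
    by apply: lattice_combination => // i; rewrite rpred_nat.
  exact: lattice_pointsN.
- rewrite lt_neqAle sumr_ge0 ?andbT => [|i _]; last by case/andP: (u01 i).
  apply: contra sum_neq0; rewrite eq_sym psumr_eq0 => [/allP u0|i _];
    last first.
    by case/andP: (u01 i).
  apply/eqP/big1 => i _; apply/eqP; apply: contraT => wi.
  have := u0 i (mem_index_enum i); rewrite wi /= subr_eq0 eq_sym => /eqP wi1.
  by have /andP[_] := w01 i; rewrite wi1 ltxx.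
rewrite big_split /= sumrN lerD2r.
apply: (@le_trans _ _ (\sum_(i < n) 1)); last by rewrite sumr_const card_ord.
by apply: ler_sum => i _; rewrite lern1 leq_b1.
Qed.

Lemma box_enumeration (R : realType) (d n : nat) (v : 'I_n -> 'rV[R]_d) :
  affine_free v ->
  exists (J : finType) (b : J -> 'I_n -> R) (ht : J -> nat),
    [/\ injective b, forall j, box v (b j),
        forall w, box v w -> exists j, b j = w
      & forall j, \sum_i b j i = (ht j)%:R].
Proof.
move=> vfree; have fin := finite_box vfree.
pose b (j : fset_set (box v)) : 'I_n -> R := \val j.
have b_box j : box v (b j).
  by have := valP j; rewrite in_fset_set // inE.
exists (fset_set (box v) : finType), b, (fun j => Num.truncn (\sum_i b j i)).
split=> [|//|w wbox|j]; first exact: val_inj.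
  have w_in : w \in fset_set (box v) by rewrite in_fset_set // inE.
  by exists [` w_in]%fset.
case: (b_box j) => b01 sumZ _; rewrite truncnK // natrEint sumZ /=.
by apply: sumr_ge0 => i _; case/andP: (b01 i).
Qed.

(** * Necessity of [k <= l] *)

Lemma coef_block_vector (d k l a m : nat) :
  (\sum_(j < d.+1) @block_vector d k l a j *: 'X^j : {poly int})`_m
  = if m == 0%N then 1 else if (k < m <= d - l)%N then a%:Z else 0.
Proof.
rewrite coef_sum; have [md|dm] := ltnP m d.+1; last first.
  rewrite big1 => [|j _].
    have -> : (m == 0)%N = false by lia.
    by have -> : (k < m <= d - l)%N = false by lia.
  rewrite coefZ coefXn; have -> : (m == j)%N = false by have := ltn_ord j; lia.
  by rewrite mulr0.
rewrite (bigD1 (Ordinal md)) //= coefZ coefXn eqxx mulr1 big1 ?addr0 // => j jm.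
rewrite coefZ coefXn; case: eqP => [e|]; last by rewrite mulr0.
by case/eqP: jm; apply: val_inj.
Qed.

Lemma coef01_oneBX_exp (n : nat) :
  (((1 - 'X) ^+ n : {poly int})`_0 = 1) *
  (((1 - 'X) ^+ n : {poly int})`_1 = - n%:Z).
Proof.
elim: n => [|n [IH0 IH1]]; first by rewrite expr0 !coefC.
by rewrite exprS mulrBl mul1r !coefB !coefXM /= IH0 IH1; split; lia.
Qed.

(** Degree 0 gives [ehrhart P 0 = 1]; degree 1 gives [ehrhart P 1 - (d + 1) * ehrhart P 0 = 0], as
    the entry of index 1 vanishes for [k > 0]. *)
Lemma block_delta_vector_card (R : realType) (d k l a : nat)
    (P : set 'rV[R]_d) :
  (0 < d)%N -> (0 < k)%N -> is_delta_vector P (@block_vector d k l a) ->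
  ehrhart P 1 = d.+1.
Proof.
move=> d0 k0 hP.
have := hP 0%N; have := hP 1%N.
rewrite /series_mul !coef_block_vector !big_ord_recl !big_ord0 /=.
rewrite !coef01_oneBX_exp ltnNge k0 /=.
by rewrite /bump /= addn0 subnn !subn0; lia.
Qed.

Lemma delta_block_vector_le (R : realType) (d k l a : nat) (P : set 'rV[R]_d) :
  (0 < d)%N -> (k + l <= d - 1)%N -> (0 < a)%N ->
  integral_polytope P -> has_dim P d ->
  is_delta_vector P (@block_vector d k l a) -> (k <= l)%N.
Proof.
move=> d0 kld a0 [Pconv PZ] [[x [xfree xP]] _] hdelta.
have [->//|k0] := posnP k.
have card1 := block_delta_vector_card d0 k0 hdelta.
have [n [v [PE v_inj vP]]] := convex_polytope_vertices Pconv.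
have vZ i : lattice_points (v i) by apply: PZ.
case: n v PE v_inj vP vZ => [|r] v PE v_inj vP vZ.
  have := xP ord0; rewrite PE => -[w [_ + _]]; rewrite big_ord0 => /eqP.
  by rewrite eq_sym oner_eq0.
have xv i : conv_hull v (x i) by rewrite -PE.
have [dr vfree] := conv_hull_affinely_independent xfree xv.
(* The [r + 1] distinct vertices are lattice points of [P], of which there are only [d + 1]. *)
have rd : (r <= d)%N.
  rewrite -ltnS -card1 /ehrhart.
  have -> : [set 1%:R *: x | x in P] = P.
    by rewrite -[RHS]image_id; apply: eq_imagel => y _; rewrite scale1r.
  have -> : r.+1 = #|` [fset v i | i in 'I_r.+1]%fset|.
    by rewrite card_imfset //= -cardE card_ord.
  apply/fsubset_leq_card/fsubsetP => y /imfsetP[i _ ->].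
  rewrite in_fset_set ?inE /=.
    by rewrite PE; split=> //; exact: conv_hull_generator.
  by rewrite PE; exact: finite_conv_hull_lattice.
have rd_eq : d = r by apply/eqP; rewrite eqn_leq dr rd.
have {}vfree := affinely_independent_free (vfree rd_eq).
have [J [b [ht [b_inj b_box box_b sum_b]]]] := box_enumeration vfree.
have coef_ht m : (\sum_j 'X^(ht j) : {poly int})`_m =
    if m == 0%N then 1 else if (k < m <= d - l)%N then a%:Z else 0.
  rewrite -coef_block_vector -hdelta.
  have := delta_simplex vZ vfree b_inj b_box box_b sum_b m.
  by rewrite -PE -rd_eq.
(* A height that occurs has a nonzero coefficient. *)
have ht_range j : ht j = 0%N \/ (k < ht j)%N.
  have := coef_ht (ht j); rewrite coef_sum_Xn.
  have : (0 < #|[set i | ht i == ht j]%SET|)%N.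
    by apply/card_gt0P; exists j; rewrite inE.
  by case: eqP => [|_]; [left|case: ifP; [right; lia|lia]].
(* The last entry [a] has index [d - l], which exceeds [k] because [k + l <= d - 1]. *)
have [j htj] : exists j, ht j = (d - l)%N.
  have := coef_ht (d - l)%N; rewrite coef_sum_Xn leqnn andbT.
  have -> : ((d - l)%N == 0%N) = false by lia.
  have -> : (k < d - l)%N by lia.
  move=> card_eq; have : (0 < #|[set i | ht i == (d - l)%N]%SET|)%N by lia.
  by case/card_gt0P => j; rewrite inE => /eqP; exists j.
have sum_neq0 : \sum_i b j i != 0 by rewrite sum_b htj pnatr_eq0; lia.
have [u [u_box u_gt0 u_le]] := box_opp vZ (b_box j) sum_neq0.
have [j' bj'] := box_b u u_box.
rewrite -bj' !sum_b htj in u_gt0 u_le.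
rewrite lerBrDr -natrD ler_nat in u_le; rewrite ltr0n in u_gt0.
by case: (ht_range j') => [|?]; lia.
Qed.

(** * Sufficiency: lattice simplices and the arithmetic of the weights *)

Lemma affine_free_independent (R : realType) (d n : nat)
    (v : 'I_n.+1 -> 'rV[R]_d) :
  affine_free v -> affinely_independent v.
Proof.
move=> vfree; apply: inj_row_free => u; rewrite mulmx_sum_row => uA.
pose w i := if unlift ord0 i is Some j then u 0 j else - \sum_j u 0 j.
have w0 : w ord0 = - \sum_j u 0 j by rewrite /w unlift_none.
have wl j : w (lift ord0 j) = u 0 j by rewrite /w liftK.
have sum_w : \sum_i w i = 0.
  by rewrite big_ord_recl w0 (eq_bigr _ (fun j _ => wl j)) addNr.
have comb_w : combination v w = 0.
  rewrite -uA /combination big_ord_recl w0 scaleNr scaler_suml -sumrN.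
  rewrite -big_split /=; apply: eq_bigr => j _.
  by rewrite wl rowK scalerBr addrC.
by apply/rowP => j; rewrite mxE -wl (vfree _ sum_w comb_w).
Qed.

Lemma lattice_simplex_integral (R : realType) (d : nat)
    (v : 'I_d.+1 -> 'rV[R]_d) :
  affine_free v -> (forall i, lattice_points (v i)) ->
  integral_polytope (conv_hull v) /\ has_dim (conv_hull v) d.
Proof.
move=> vfree vZ; split; split.
- by exists d.+1, v.
- by move=> x /vertex_conv_hull[i ->].
- exists v; split; first exact: affine_free_independent.
  exact: conv_hull_generator.
- by move=> m x /eqP xfree _; rewrite -xfree rank_leq_col.
Qed.

(* Residues mod [M] of the generator of the box group; index 0 carries [- N]. *)
Definition weight (M N k i : nat) : nat :=
  if i == 0%N then (M - N)%N
  else if (i <= N + k)%N then 1%N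
  else if (i <= N + k + k)%N then (M - 1)%N else 0%N.

(** The weights form four blocks, of lengths 1, [N + k], [k] and [d - (N + 2 k)]. A general [F]
    allows residues of multiples to be summed. *)
Lemma sum_weight (M N k d : nat) (F : nat -> nat) : (N + k + k <= d)%N ->
  (\sum_(i < d.+1) F (weight M N k i))%N =
  (F (M - N) + (N + k) * F 1 + k * F (M - 1) + (d - (N + k + k)) * F 0)%N.
Proof.
move=> Nkd.
rewrite -(big_mkord xpredT (fun i => F (weight M N k i))).
rewrite (@big_cat_nat _ _ _ 1) //= big_nat1.
rewrite (@big_cat_nat _ _ _ (N + k + k).+1) //=.
rewrite (@big_cat_nat _ _ _ (N + k).+1) //=; last by rewrite ltnS leq_addr.
have e1 : (\sum_(1 <= i < (N + k).+1) F (weight M N k i))%N = ((N + k) * F 1)%N.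
  rewrite -[X in (X * _)%N]subn0 -subSS -sum_nat_const_nat.
  rewrite !big_nat; apply: eq_bigr => i ?; rewrite /weight.
  by do ![case: ifP => ?]; congr F; lia.
have e2 : (\sum_((N + k).+1 <= i < (N + k + k).+1) F (weight M N k i))%N
    = (k * F (M - 1))%N.
  rewrite -[X in (X * _)%N](addKn (N + k)) -subSS -sum_nat_const_nat.
  rewrite !big_nat; apply: eq_bigr => i ?; rewrite /weight.
  by do ![case: ifP => ?]; congr F; lia.
have e3 : (\sum_((N + k + k).+1 <= i < d.+1) F (weight M N k i))%N
    = ((d - (N + k + k)) * F 0)%N.
  rewrite -subSS -sum_nat_const_nat.
  rewrite !big_nat; apply: eq_bigr => i ?; rewrite /weight.
  by do ![case: ifP => ?]; congr F; lia.
by rewrite e1 e2 e3 /weight /= !addnA.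
Qed.

(** For [0 < j <= a N] this is [k] plus the ceiling of [j / a], which there agrees with that of
    [N j / M]; the quotient form shows that each value occurs [a] times. *)
Definition height (a k j : nat) : nat :=
  if j is j'.+1 then (k + 1 + j' %/ a)%N else 0%N.

(** For [j > 0] and [q = (j - 1) %/ a], the residues are [(q + 1) M - N j] once, [j] for [N + k]
    indices, [M - j] for [k] indices, and 0. The terms in [j] cancel, leaving [(k + 1 + q) M]. *)
Lemma sum_weight_mod (a N k d j : nat) : (0 < a)%N -> (0 < N)%N ->
  (N + k + k <= d)%N -> (j < (a * N).+1)%N ->
  (\sum_(i < d.+1) (j * weight (a * N).+1 N k i) %% (a * N).+1)%N
  = ((a * N).+1 * height a k j)%N.
Proof.
move=> a0 N0 Nkd; set M := (a * N).+1.
rewrite (@sum_weight M N k d (fun c => (j * c) %% M)%N) //.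
case: j => [|j] jM; first by rewrite !mul0n !mod0n !muln0.
rewrite muln0 mod0n muln0 addn0 muln1 (modn_small jM) /height.
set q := (j %/ a)%N; set s := (j %% a)%N.
have jE : j = (q * a + s)%N by exact: divn_eq.
have sa : (s < a)%N by rewrite ltn_mod.
have qN : (q < N)%N by rewrite ltn_divLR // mulnC.
(* The value is [q + 1 + N (a - 1 - s)], nonnegative by [s < a] and below [M] by [q < N]. *)
have -> : ((j.+1 * (M - N)) %% M = q.+1 * M - N * j.+1)%N.
  have -> : (j.+1 * (M - N) = (j - q) * M + (q.+1 * M - N * j.+1))%N.
    by rewrite /M jE; nia.
  by rewrite modnMDl modn_small // /M jE; nia.
have -> : ((j.+1 * (M - 1)) %% M = M - j.+1)%N.
  have -> : (j.+1 * (M - 1) = j * M + (M - j.+1))%N.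
    by rewrite mulnBr; nia.
  by rewrite modnMDl modn_small //; lia.
have : (N * j.+1 <= q.+1 * M)%N by rewrite /M jE; nia.
by nia.
Qed.

Lemma int_itv01_eq0 (R : realType) (x : R) :
  x \is a Num.int -> -1 < x < 1 -> x = 0.
Proof.
move=> xZ; rewrite -ltr_norml => x1; apply/eqP; apply: contraTT x1 => x_neq0.
by rewrite -leNgt norm_intr_ge1.
Qed.

(* The vertices are 0, the row (M, - c_2, .., - c_(d+1)) and the unit vectors
   e_2, .., e_(d+1). *)
Definition cyclic_simplex (R : realType) (d M : nat) (c : nat -> nat)
    (i : 'I_d.+2) : 'rV[R]_d.+1 :=
  \row_q (if i == 0%N :> nat then 0
          else if i == 1%N :> nat then
            (if q == 0%N :> nat then M%:R else - (c q.+1)%:R)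
          else (q.+1 == i :> nat)%:R).

(** * Box points of the cyclic simplex *)

Section CyclicSimplex.
Context (R : realType) (d M : nat) (c : nat -> nat).
Hypotheses (M0 : (0 < M)%N) (c1 : c 1%N = 1%N).

Local Notation v := (@cyclic_simplex R d M c).
Local Notation one := (lift ord0 ord0 : 'I_d.+2).

Lemma cyclic_simplex_lattice i : lattice_points (v i).
Proof.
move=> q; rewrite mxE; do ![case: ifP => _]; rewrite ?rpredN ?rpred_nat //.
Qed.

Lemma combination_cyclic_simplex0 w :
  combination v w 0 ord0 = w one * M%:R.
Proof.
rewrite summxE !big_ord_recl !mxE /= mulr0 add0r big1 ?addr0 // => p _.
by rewrite !mxE /= mulr0.
Qed.

Lemma combination_cyclic_simplexS w (p : 'I_d) :
  combination v w 0 (lift ord0 p)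
  = w (lift ord0 (lift ord0 p)) - w one * (c p.+2)%:R.
Proof.
rewrite summxE !big_ord_recl !mxE /= mulr0 add0r addrC mulrN; congr (_ - _).
rewrite (bigD1 p) //= !mxE /= eqxx mulr1 big1 ?addr0 // => i ip.
rewrite !mxE /= /bump /= !add1n !eqSS eq_sym.
by rewrite (negbTE (ip : i != p :> nat)) mulr0.
Qed.

Lemma cyclic_simplex_affine_free : affine_free v.
Proof.
move=> w sum_w comb_w.
have M_neq0 : M%:R != 0 :> R by rewrite pnatr_eq0 -lt0n.
have w1 : w one = 0.
  have := combination_cyclic_simplex0 w; rewrite comb_w mxE => /esym/eqP.
  by rewrite mulf_eq0 (negbTE M_neq0) orbF => /eqP.
have wS p : w (lift ord0 (lift ord0 p)) = 0.
  have := combination_cyclic_simplexS w p.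
  by rewrite comb_w mxE w1 mul0r subr0.
move=> i; have [p ->|->] := unliftP ord0 i.
  by have [p' ->|->] := unliftP ord0 p.
by move: sum_w; rewrite !big_ord_recl w1 big1 ?addr0 // => p _; rewrite wS.
Qed.

(** Modulo 1, the coordinate at [one] determines the others: the lattice condition fixes those from
    index 2 on, and the integral sum fixes index 0. Coordinates in [0, 1) leave no choice. *)
Lemma box_cyclic_simplex_eq w u :
  box v w -> box v u -> w one = u one -> w = u.
Proof.
move=> [w01 sum_w comb_w] [u01 sum_u comb_u] wu1.
pose x i := w i + - u i.
have x1 : x one = 0 by rewrite /x wu1 subrr.
have comb_x : lattice_points (combination v x).
  by rewrite combinationD combinationN; apply/lattice_pointsD/lattice_pointsN.
have x_lt i : -1 < x i < 1.
  by case/andP: (w01 i); case/andP: (u01 i); rewrite /x; lra.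
have xS p : x (lift ord0 (lift ord0 p)) = 0.
  apply: int_itv01_eq0 => //; have := comb_x (lift ord0 p).
  by rewrite combination_cyclic_simplexS x1 mul0r subr0.
have x0 : x ord0 = 0.
  apply: int_itv01_eq0 => //.
  have : \sum_i x i \is a Num.int by rewrite big_split /= sumrN rpredB.
  by rewrite !big_ord_recl x1 big1 ?addr0 // => p _; rewrite xS.
apply/funext => i; apply/eqP; rewrite -subr_eq0 -/(x i); apply/eqP.
have [p ->|-> //] := unliftP ord0 i.
by have [p' ->|->] := unliftP ord0 p.
Qed.

(** Multiples modulo 1 of the generator [c i / M]; with [c 1 = 1], the coordinate at [one] is
    [j / M] and recovers [j]. *)
Definition cyclic_box (j : 'I_M) (i : 'I_d.+2) : R :=
  ((j * c i) %% M)%:R / M%:R.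

Lemma cyclic_box_one j : cyclic_box j one = j%:R / M%:R.
Proof. by rewrite /cyclic_box c1 muln1 modn_small. Qed.

Lemma cyclic_box_inj : injective cyclic_box.
Proof.
have M_neq0 : M%:R != 0 :> R by rewrite pnatr_eq0 -lt0n.
move=> j j' e; have := cyclic_box_one j; rewrite e cyclic_box_one.
by move/(divIf M_neq0)/eqP; rewrite eqr_nat => /eqP/val_inj.
Qed.

(** Integrality of the sum is assumed because the lattice condition says nothing about the
    coordinate of index 0, whose vertex is the origin. *)
Lemma cyclic_box_box j : \sum_i cyclic_box j i \is a Num.int ->
  box v (cyclic_box j).
Proof.
have M_gt0 : 0 < M%:R :> R by rewrite ltr0n.
have M_neq0 : M%:R != 0 :> R by rewrite gt_eqF.
move=> sumZ; split=> // [i|q].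
  rewrite divr_ge0 ?ler0n //= ltr_pdivrMr // mul1r ltr_nat.
  by rewrite ltn_mod.
have [p ->|->] := unliftP ord0 q; last first.
  by rewrite combination_cyclic_simplex0 cyclic_box_one divfK // rpred_nat.
rewrite combination_cyclic_simplexS cyclic_box_one /cyclic_box.
rewrite -[c (lift _ _)]/(c p.+2).
have -> : ((j * c p.+2) %% M)%:R / M%:R - j%:R / M%:R * (c p.+2)%:R
    = - ((j * c p.+2) %/ M)%:R :> R.
  apply: (mulIf M_neq0); rewrite mulrBl [X in _ - X]mulrAC !divfK //.
  rewrite mulNr -!natrM {2}(divn_eq (j * c p.+2) M) natrD natrM.
  by rewrite opprD addrCA subrr addr0.
by rewrite rpredN rpred_nat.
Qed.

(** The first coordinate of the combination is [M] times [w one], hence a natural number [j < M];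
    the [j]-th multiple of the generator agrees with [w] at [one]. *)
Lemma box_cyclic_box w :
  (forall j, \sum_i cyclic_box j i \is a Num.int) ->
  box v w -> exists j, cyclic_box j = w.
Proof.
have M_gt0 : 0 < M%:R :> R by rewrite ltr0n.
have M_neq0 : M%:R != 0 :> R by rewrite gt_eqF.
move=> sumZ wbox; case: (wbox) => w01 _ comb_w.
have /andP[w0 w1] := w01 one.
have : w one * M%:R \is a Num.nat.
  rewrite natrEint -combination_cyclic_simplex0 comb_w.
  by rewrite combination_cyclic_simplex0 mulr_ge0.
move=> /natrP[j wj].
have jM : (j < M)%N by rewrite -(ltr_nat R) -wj gtr_pMl.
exists (Ordinal jM); apply: box_cyclic_simplex_eq => //.
  exact: cyclic_box_box.
by rewrite cyclic_box_one /= -wj mulfK.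
Qed.

End CyclicSimplex.

(** * Counting the heights, and the theorem *)

Lemma sum_height (V : nmodType) (F : nat -> V) (a N : nat) :
  \sum_(j < a * N) F (j %/ a)%N = \sum_(q < N) F q *+ a.
Proof.
have [->|a0] := posnP a; first by rewrite mul0n big_ord0 big1.
elim: N => [|N IH]; first by rewrite muln0 !big_ord0.
rewrite mulnS addnC big_split_ord big_ord_recr /= IH; congr (_ + _).
rewrite (eq_bigr (fun _ => F N)) ?sumr_const ?card_ord // => s _ /=.
by rewrite mulnC divnMDl // divn_small ?addn0.
Qed.

Lemma coef_sum_height (a N k m : nat) :
  (\sum_(j < (a * N).+1) 'X^(height a k j) : {poly int})`_m
  = if m == 0%N then 1 else if (k < m <= k + N)%N then a%:Z else 0.
Proof.
rewrite big_ord_recl /= coefD coefXn.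
rewrite (sum_height (fun q => 'X^(k + 1 + q) : {poly int})) coef_sum.
under eq_bigr do rewrite coefMn coefXn.
have [->|m0] := eqVneq m 0%N.
  rewrite big1 ?addr0 // => q _.
  have -> : (0 == k + 1 + q)%N = false by lia.
  by rewrite mul0rn.
rewrite add0r; case: ifP => hm; last first.
  rewrite big1 // => q _.
  have -> : (m == k + 1 + q)%N = false by have := ltn_ord q; lia.
  by rewrite mul0rn.
have qN : (m - k - 1 < N)%N by lia.
rewrite (bigD1 (Ordinal qN)) //= big1 => [|q qm].
  have -> : (m == k + 1 + (m - k - 1))%N by lia.
  by rewrite addr0 natz.
have -> : (m == k + 1 + q)%N = false.
  by apply: contraNF qm => /eqP mE; apply/eqP/val_inj => /=; lia.
by rewrite mul0rn.
Qed.

(** The ambient dimension is [d.+1], as the simplex reserves its first coordinate for the modulus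
    [M]. *)
Lemma delta_block_vector_exists (R : realType) (d k l a : nat) :
  (k + l <= d)%N -> (0 < a)%N -> (k <= l)%N ->
  exists P : set 'rV[R]_d.+1,
    [/\ integral_polytope P, has_dim P d.+1
      & is_delta_vector P (@block_vector d.+1 k l a)].
Proof.
move=> kld a0 kl; pose N := (d.+1 - l - k)%N; pose M := (a * N).+1.
pose c := weight M N k; pose v := @cyclic_simplex R d M c.
have N0 : (0 < N)%N by rewrite /N; lia.
have c1 : c 1%N = 1%N by rewrite /c /weight /=; case: ifP => //; lia.
have M_neq0 : M%:R != 0 :> R by rewrite pnatr_eq0.
have sum_b (j : 'I_M) : \sum_i @cyclic_box R d M c j i = (height a k j)%:R.
  rewrite -mulr_suml -natr_sum sum_weight_mod //.
    by rewrite natrM mulrAC mulfV ?mul1r.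
  (* Here [k <= l] enters: the blocks of weights fit only if [N + 2 k <= d + 1]. *)
  by rewrite /N; lia.
have sumZ (j : 'I_M) : \sum_i @cyclic_box R d M c j i \is a Num.int.
  by rewrite sum_b rpred_nat.
have vfree : affine_free v by exact: cyclic_simplex_affine_free.
have vZ i : lattice_points (v i) by exact: cyclic_simplex_lattice.
have [Pint Pdim] := lattice_simplex_integral vfree vZ.
exists (conv_hull v); split=> // m.
rewrite (delta_simplex vZ vfree (b := @cyclic_box R d M c)
  (ht := fun j => height a k j)) //.
- rewrite coef_sum_height coef_block_vector.
  by have -> : (k + N = d.+1 - l)%N by rewrite /N; lia.
- exact: cyclic_box_inj.
- by move=> j; apply: cyclic_box_box.
- by move=> w; apply: box_cyclic_box.
Qed.

Theorem theorem0p1 (R : realType) (d k l a : nat) (hd : (1 <= d)%N)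
    (hkl : (k + l <= d - 1)%N) (ha : (1 <= a)%N) :
  (exists P : set 'rV[R]_d,
     [/\ integral_polytope P, has_dim P d
       & is_delta_vector P (@block_vector d k l a)])
  <-> (k <= l)%N.
Proof.
split=> [[P [Pint Pdim Pdelta]]|kl].
  exact: (delta_block_vector_le hd hkl ha Pint Pdim Pdelta).
case: d hd hkl => [//|d] _; rewrite subSS subn0 => hkl.
exact: delta_block_vector_exists.
Qed.
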